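(* Let $(X,d)$ be a countably generated Lorentzian metric space and let $\{p^k\}_{k\in\mathbb{N}}$ be a generating sequence for $X$. Then the function $p:X\times X\to[0,+\infty)$ defined by $$p(x,y):=\sum_{m=1}^{\infty}2^{-m}\frac{\|d_y-d_x\|^+_{X^m}}{1+\|d_y-d_x\|^+_{X^m}}+\sum_{m=1}^{\infty}2^{-m}\frac{\|d^x-d^y\|^+_{X^m}}{1+\|d^x-d^y\|^+_{X^m}}$$ is a quasi-metric for the fine quasi-uniformity of $(X,d)$ (that is, $p$ is a quasi-metric and the quasi-uniformity it induces is the fine quasi-uniformity). In particular, $J=\{(x,y)\in X\times X: p(x,y)=0\}$, and the metric $$\gamma(x,y):=\sum_{m=1}^{\infty}2^{-m}\frac{\|d_x-d_y\|_{X^m}}{1+\|d_x-d_y\|_{X^m}}+\sum_{m=1}^{\infty}2^{-m}\frac{\|d^x-d^y\|_{X^m}}{1+\|d^x-d^y\|_{X^m}}$$ is Lipschitz equivalent to $p+p^{-1}$; in fact $\gamma\le p+p^{-1}\le 2\gamma$, where $p^{-1}(x,y):=p(y,x)$.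
   Context: Let $X$ be a set and $d:X\times X\to[0,+\infty)$ a function. Notation: $d_x(y)=d^y(x)=d(x,y)$; $x\ll y$ iff $d(x,y)>0$; $I^+(x)=\{y: x\ll y\}$, $I^-(x)=\{y: y\ll x\}$; for $A\subset X$, $I^\pm(A)=\bigcup_{p\in A}I^\pm(p)$ and $I(A)=I^+(A)\cap I^-(A)$; $I(p^1,\dots,p^m):=I(\{p^1,\dots,p^m\})$. For $\epsilon>0$, $I_\epsilon=\{(x,y): d(x,y)\ge\epsilon\}$. $(X,d)$ is a Lorentzian metric space if: (i) $d(x,z)\ge d(x,y)+d(y,z)$ whenever $d(x,y)>0$ and $d(y,z)>0$; (ii) there is a topology $T$ on $X$ such that $d$ is continuous in the product topology and, for every $x,y\in X$ and $\epsilon>0$, the set $I_\epsilon\cap(\overline{I(x,y)}\times\overline{I(x,y)})$ is compact; (iii) for all $x\ne y$ there is $z\in X$ with $d(x,z)\ne d(y,z)$ or $d(z,x)\ne d(z,y)$. A generating sequence is a sequence $\{p^k\}_{k\in\mathbb{N}}$ in $X$ with $I(\{p^k:k\in\mathbb{N}\})=X$; $X$ is countably generated if it has a countable generating set; then the topology in (ii) is unique and $X$ is endowed with it. $X^m:=\overline{I(p^1,\dots,p^m)}\cup\{p^1,\dots,p^m\}$ (a compact set). For continuous $f$ and compact $K$: $\|f\|_K=\sup_K|f|$ and $\|f\|_K^+=\sup_K\max(f,0)$. The extended causal relation is $J=\{(x,y): d(q,y)\ge d(q,x)\text{ and }d(x,q)\ge d(y,q)\ \forall q\in X\}$. A quasi-uniformity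 on $X$ is a filter on $X\times X$ all of whose elements contain the diagonal and such that for every element $U$ there is an element $V$ with $V\circ V\subset U$. The fine quasi-uniformity of $(X,d)$ is the one generated (as a filter) by the sets $\{(x,y): \sup_K(d_y-d_x)<a,\ \sup_K(d^x-d^y)<b\}$ with $K\subset X$ compact and $a,b\in(0,+\infty]$. A quasi-pseudo-metric is a function $p:X\times X\to[0,+\infty)$ with $p(x,x)=0$ and $p(x,z)\le p(x,y)+p(y,z)$; it is a quasi-metric if $p(x,y)=p(y,x)=0$ implies $x=y$. The quasi-uniformity induced by $p$ is the filter generated by the sets $\{(x,y): p(x,y)<1/n\}$, $n\in\mathbb{N}$. *)

(* Defs.v *)
From HB Require Import structures.
From mathcomp Require Import all_boot all_order all_algebra.
From mathcomp Require Import all_classical all_reals all_analysis.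
From mathcomp Require Import ring lra.

Set Implicit Arguments.
Unset Strict Implicit.
Unset Printing Implicit Defensive.

Import Order.TTheory GRing.Theory Num.Theory.
Import numFieldNormedType.Exports.

Local Open Scope classical_set_scope.
Local Open Scope ring_scope.

(* Below, the function d_x is written [d x] and the function d^x is written
   [d^~ x], i.e. [fun z => d z x]. *)

Section chronology.
Context {R : realType} {X : Type}.
Implicit Types (d : X -> X -> R) (A : set X).

Definition future d (x : X) : set X := [set y | 0 < d x y].

Definition past d (x : X) : set X := [set y | 0 < d y x].

(* I(A) = I^+(A) `&` I^-(A); the two bounding points need not be the same. *)
Definition diamond d A : set X :=
  (\bigcup_(p in A) future d p) `&` (\bigcup_(p in A) past d p).

Definition distant d (e : R) : set (X * X) := [set z | e <= d z.1 z.2].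

Definition generating d A : Prop := diamond d A = setT.

Definition countably_generated d : Prop :=
  exists A : set X, countable A /\ generating d A.

Definition generating_sequence d (s : nat -> X) : Prop :=
  generating d (range s).

Definition extended_causal d : set (X * X) :=
  [set z | forall q, d q z.1 <= d q z.2 /\ d z.2 q <= d z.1 q].

End chronology.

(* The topology T of condition (ii) is that of the topologicalType X. *)
Record lorentzian_metric_space {R : realType} {X : topologicalType}
    (d : X -> X -> R) : Prop := LorentzianMetricSpace {
  lms_ge0 : forall x y, 0 <= d x y ;
  lms_reverse_triangle : forall x y z,
    0 < d x y -> 0 < d y z -> d x y + d y z <= d x z ;
  lms_continuous : continuous (fun z : X * X => d z.1 z.2) ;
  lms_compact : forall (x y : X) (e : R), 0 < e ->
    compact (distant d e `&`
      (closure (diamond d [set x; y]) `*` closure (diamond d [set x; y]))) ;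
  lms_separating : forall x y : X, x <> y ->
    exists z, d x z <> d y z \/ d z x <> d z y }.

(* [s 0, s 1, ...] stands for p^1, p^2, ..., so X^m involves the first m terms
   [s 0, ..., s m.-1]. *)
Definition exhaustion {R : realType} {X : topologicalType}
    (d : X -> X -> R) (s : nat -> X) (m : nat) : set X :=
  closure (diamond d (s @` `I_m)) `|` (s @` `I_m).

Section norms.
Context {R : realType} {X : Type}.

Definition sup_norm (K : set X) (f : X -> R) : R := sup [set `|f z| | z in K].

Definition sup_norm_pos (K : set X) (f : X -> R) : R :=
  sup [set Num.max (f z) 0 | z in K].

End norms.

Section quasi_uniformities.
Context {X : Type}.
Implicit Types U : set_system (X * X).

Record quasi_uniformity U : Prop := QuasiUniformity {
  qu_filter : Filter U ;
  qu_diagonal : forall A, U A -> diagonal `<=` A ;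
  qu_split : forall A, U A -> exists2 B, U B & (B \; B)%relation `<=` A }.

Lemma quasi_uniformity_smallest (G : set_system (X * X)) :
  (forall A, G A -> diagonal `<=` A) ->
  (forall A, G A -> exists2 B, G B & (B \; B)%relation `<=` A) ->
  quasi_uniformity (smallest Filter G).
Proof.
move=> Gdiag Gsplit.
have GF : Filter (smallest Filter G) := smallest_filter_filter G.
pose F := [set A | [/\ smallest Filter G A, diagonal `<=` A &
  exists2 B, smallest Filter G B & (B \; B)%relation `<=` A]].
have FF : Filter F.
  split.
  - by split=> //; [exact: (@filterT _ (smallest Filter G)) | exists setT => //; exact: (@filterT _ (smallest Filter G))].
  - move=> A B [GA dA [A' GA' sA]] [GB dB [B' GB' sB]]; split.
    + exact: (@filterI _ (smallest Filter G)).
    + by move=> z dz; split; [exact: dA | exact: dB].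
    + exists (A' `&` B'); first exact: (@filterI _ (smallest Filter G)).
      by move=> z [y [? ?] [? ?]]; split; [apply: sA | apply: sB]; exists y.
  - move=> A B AB [GA dA [A' GA' sA]]; split.
    + exact: (@filterS _ (smallest Filter G) _ _ _ AB GA).
    + exact: subset_trans AB.
    + by exists A' => //; exact: subset_trans AB.
have sGF : smallest Filter G `<=` F.
  apply: smallest_sub => // A GA; split.
  - exact: sub_gen_smallest.
  - exact: Gdiag.
  - by have [B GB sB] := Gsplit _ GA; exists B => //; exact: sub_gen_smallest.
split.
- exact: smallest_filter_filter.
- by move=> A /sGF[].
- by move=> A /sGF[].
Qed.

End quasi_uniformities.

Section fine.
Context {R : realType} {X : topologicalType} (d : X -> X -> R).
Local Open Scope ereal_scope.

(* Suprema are taken in the extended reals, as the bounds may be +oo. *)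
Definition fine_entourage (K : set X) (a b : \bar R) : set (X * X) :=
  [set z | ereal_sup [set (d z.2 t - d z.1 t)%:E | t in K] < a /\
           ereal_sup [set (d t z.1 - d t z.2)%:E | t in K] < b].

Definition fine_quasi_uniformity : set_system (X * X) :=
  smallest Filter [set A | exists K a b,
    [/\ compact K, 0 < a, 0 < b & A = fine_entourage K a b]].

End fine.

Section quasi_metrics.
Context {R : realType} {X : Type}.
Implicit Types p g h : X -> X -> R.

Definition quasi_pseudo_metric p : Prop :=
  [/\ forall x y, 0 <= p x y,
      forall x, p x x = 0 &
      forall x y z, p x z <= p x y + p y z].

Definition quasi_metric p : Prop :=
  quasi_pseudo_metric p /\ forall x y, p x y = 0 -> p y x = 0 -> x = y.

Definition metric g : Prop :=
  [/\ forall x y, 0 <= g x y,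
      forall x y, g x y = 0 <-> x = y,
      forall x y, g x y = g y x &
      forall x y z, g x z <= g x y + g y z].

Definition induced_quasi_uniformity p : set_system (X * X) :=
  smallest Filter [set A | exists n : nat,
    (0 < n)%N /\ A = [set z | p z.1 z.2 < n%:R^-1]].

Definition quasi_metric_for (U : set_system (X * X)) p : Prop :=
  quasi_metric p /\ induced_quasi_uniformity p = U.

Definition lipschitz_equivalent g h : Prop :=
  exists c C : R, [/\ 0 < c, 0 < C &
    forall x y, c * g x y <= h x y <= C * g x y].

End quasi_metrics.

Lemma fine_quasi_uniformityP {R : realType} {X : topologicalType}
  (d : X -> X -> R) : quasi_uniformity (fine_quasi_uniformity d).
Proof.
have diag (K : set X) (f : X -> R) (a : \bar R) : (0 < a)%E ->
    (forall t, f t = 0) -> (ereal_sup [set (f t)%:E | t in K] < a)%E.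
  move=> a0 f0; apply: le_lt_trans a0.
  by apply: ge_ereal_sup => _ [t _ <-]; rewrite f0.
have half (a : \bar R) : (0 < a)%E -> exists2 e : \bar R, (0 < e)%E &
    forall u v : \bar R, (u < e -> v < e -> u + v < a)%E.
  case: a => [r| |] // r0.
  - exists (r / 2)%:E; first by rewrite lte_fin divr_gt0// -lte_fin.
    move=> u v ur vr; rewrite (splitr r) EFinD; exact: lteD.
  - by exists +oo%E => // u v; exact: lte_add_pinfty.
have add (K : set X) (f g h : X -> R) (e a : \bar R) :
    (forall u v : \bar R, (u < e -> v < e -> u + v < a)%E) ->
    (forall t, h t = f t + g t) ->
    (ereal_sup [set (f t)%:E | t in K] < e)%E ->
    (ereal_sup [set (g t)%:E | t in K] < e)%E ->
    (ereal_sup [set (h t)%:E | t in K] < a)%E.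
  move=> ea hE fe ge; apply: le_lt_trans (ea _ _ fe ge).
  apply: ge_ereal_sup => _ [t Kt <-]; rewrite hE EFinD.
  by apply: leeD; apply: ereal_sup_ubound; exists t.
apply: quasi_uniformity_smallest => A [K [a [b [cK a0 b0 ->]]]].
- by move=> [x y] /diagonalP <-; split; apply: diag => // t; rewrite subrr.
- have [e e0 ea] := half _ a0; have [e' e'0 eb] := half _ b0.
  exists (fine_entourage d K e e'); first by exists K, e, e'.
  move=> [x z] [y [/= xy1 xy2] [/= yz1 yz2]]; split => /=.
  + by apply: add ea _ xy1 yz1 => t; ring.
  + by apply: add eb _ xy2 yz2 => t; ring.
Qed.

Lemma induced_quasi_uniformityP {R : realType} {X : Type} (p : X -> X -> R) :
  quasi_pseudo_metric p -> quasi_uniformity (induced_quasi_uniformity p).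
Proof.
move=> [p0 pxx ptri]; apply: quasi_uniformity_smallest => A [n [n0 ->]].
- by move=> [x y] /diagonalP <- /=; rewrite pxx invr_gt0 ltr0n.
- exists [set z | p z.1 z.2 < (n * 2)%:R^-1].
    by exists (n * 2)%N; rewrite muln_gt0 n0.
  move=> [x z] [y /= xy yz]; apply: le_lt_trans (ptri x y z) _.
  by move: xy yz; rewrite natrM invfM; lra.
Qed.

Section generated_functions.
Context {R : realType} {X : topologicalType} (d : X -> X -> R) (s : nat -> X).

(* For u >= 0 the partial sums are nondecreasing and bounded by 1. *)
Definition weighted_series (u : nat -> R) : R :=
  \big[+%R/0]_(1 <= m <oo) (2 ^- m * (u m / (1 + u m))).

Definition generated_quasi_metric (x y : X) : R :=
  weighted_series (fun m => sup_norm_pos (exhaustion d s m) (d y \- d x)) +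
  weighted_series (fun m => sup_norm_pos (exhaustion d s m) (d^~ x \- d^~ y)).

Definition generated_metric (x y : X) : R :=
  weighted_series (fun m => sup_norm (exhaustion d s m) (d x \- d y)) +
  weighted_series (fun m => sup_norm (exhaustion d s m) (d^~ x \- d^~ y)).

End generated_functions.

(* Main.v *)
Require Import Defs.
From mathcomp Require Import all_boot all_order all_algebra.
From mathcomp Require Import all_classical all_reals all_analysis.
From mathcomp Require Import ring lra.

Import Order.TTheory GRing.Theory Num.Theory.
Import numFieldNormedType.Exports.

Local Open Scope classical_set_scope.
Local Open Scope ring_scope.

(* The closure of a diamond is compact: it lies in a slice of the compact
   set of condition (ii) for two points chosen far enough in the past and in the
   future. Hence the X^m are compact; since the diamonds of
   finitely many points are open and cover X, every compact set lies in some X^m.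
   Hence the sup norms are finite, and p(x, y) < eps controls the suprema over a
   given compact set, while conversely the suprema over X^N control p up to the tails
   of the series. The comparison of gamma with p + p^-1 holds termwise, since
   ||h|| is the maximum of ||h||^+ and ||-h||^+ and t/(1+t) is subadditive. *)

(** * Sup norms and one-sided sup norms on a set *)

Section sup_norms.
Context {R : realType} {X : Type}.
Implicit Types (K : set X) (f g h : X -> R).

Lemma sup_norm_posE K f :
  sup_norm_pos K f = sup_norm K (fun z => Num.max (f z) 0).
Proof.
by congr (sup _); apply: eq_imagel => z _; rewrite ger0_norm// le_max lexx orbT.
Qed.

Lemma sup_norm_le K f c : 0 <= c -> (forall z, K z -> `|f z| <= c) ->
  sup_norm K f <= c.
Proof.
(* On an empty [K] the supremum has the default value 0; this is where [0 <= c] enters. *)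
move=> c0 fc; have [->|/set0P K0] := eqVneq K set0.
  by rewrite /sup_norm image_set0 sup0.
apply: ge_sup; first exact: image_nonempty.
by move=> _ [z Kz <-]; exact: fc.
Qed.

(** Holds for every [f]: a set of values without a supremum gets the default value 0. *)
Lemma sup_norm_ge0 K f : 0 <= sup_norm K f.
Proof.
rewrite /sup_norm; have [hs|/sup_out->//] := pselect (has_sup [set `|f z| | z in K]).
have [_ [z Kz _]] := hs.1.
by apply: le_trans (normr_ge0 (f z)) _; apply: sup_upper_bound => //; exists z.
Qed.

(** Excludes the default value 0 of [sup] on unbounded sets, so that the norm dominates the
    pointwise values. *)
Definition bounded_on K f := has_ubound [set `|f z| | z in K].

Lemma le_sup_norm K f z : bounded_on K f -> K z -> `|f z| <= sup_norm K f.
Proof. by move=> bf Kz; apply: ub_le_sup => //; exists z. Qed.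

Lemma sup_norm_pos_le K f c : 0 <= c -> (forall z, K z -> f z <= c) ->
  sup_norm_pos K f <= c.
Proof.
move=> c0 fc; rewrite sup_norm_posE; apply: sup_norm_le => // z Kz.
by rewrite ger0_norm ?ge_max ?c0 ?fc// le_max lexx orbT.
Qed.

Lemma sup_norm_pos_ge0 K f : 0 <= sup_norm_pos K f.
Proof. by rewrite sup_norm_posE sup_norm_ge0. Qed.

Lemma le_sup_norm_pos K f z : bounded_on K f -> K z -> f z <= sup_norm_pos K f.
Proof.
move=> [M bM] Kz; rewrite sup_norm_posE.
apply: (@le_trans _ _ `|Num.max (f z) 0|).
  by rewrite (le_trans _ (ler_norm _))// le_max lexx.
apply: le_sup_norm => //; exists M => _ [t Kt <-].
apply: le_trans (bM `|f t| _); last by exists t.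
by rewrite ger0_norm ?ge_max ?normr_ge0 ?ler_norm// le_max lexx orbT.
Qed.

Lemma bounded_onN K f : bounded_on K f -> bounded_on K (\- f).
Proof.
case=> M bM; exists M => _ [t Kt <-]; rewrite /= normrN.
by apply: bM; exists t.
Qed.

Lemma sup_normN K f : sup_norm K (\- f) = sup_norm K f.
Proof. by congr (sup _); apply: eq_imagel => z _; rewrite normrN. Qed.

Lemma sup_normD K f g : bounded_on K f -> bounded_on K g ->
  sup_norm K (f \+ g) <= sup_norm K f + sup_norm K g.
Proof.
move=> bf bg; apply: sup_norm_le => [|z Kz]; first by rewrite addr_ge0 ?sup_norm_ge0.
by rewrite (le_trans (ler_normD _ _))// lerD ?le_sup_norm.
Qed.

Lemma sup_norm_posD K f g : bounded_on K f -> bounded_on K g ->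
  sup_norm_pos K (f \+ g) <= sup_norm_pos K f + sup_norm_pos K g.
Proof.
move=> bf bg; apply: sup_norm_pos_le => [|z Kz].
  by rewrite addr_ge0 ?sup_norm_pos_ge0.
by rewrite lerD ?le_sup_norm_pos.
Qed.

Lemma sup_norm_pos_le_sup_norm K f : bounded_on K f ->
  sup_norm_pos K f <= sup_norm K f.
Proof.
move=> bf; apply: sup_norm_pos_le => [|z Kz]; first exact: sup_norm_ge0.
by rewrite (le_trans (ler_norm _))// le_sup_norm.
Qed.

(** Each [|f z|] is [f z] or [- f z], and each sign is controlled by its own one-sided norm. *)
Lemma sup_norm_le_max K f : bounded_on K f ->
  sup_norm K f <= Num.max (sup_norm_pos K f) (sup_norm_pos K (\- f)).
Proof.
move=> bf; apply: sup_norm_le => [|z Kz]; first by rewrite le_max sup_norm_pos_ge0.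
rewrite ler_norml lerNl !le_max (le_sup_norm_pos _ _ _ bf Kz) andbT.
by rewrite (le_sup_norm_pos _ (\- f) _ (bounded_onN _ _ bf) Kz) orbT.
Qed.

Lemma le_sup_norm_posS K L f : K `<=` L -> bounded_on L f ->
  sup_norm_pos K f <= sup_norm_pos L f.
Proof.
move=> KL bf; apply: sup_norm_pos_le => [|z /KL]; first exact: sup_norm_pos_ge0.
exact: le_sup_norm_pos.
Qed.

End sup_norms.

Lemma continuous_bounded_on {R : realType} {X : topologicalType}
    (K : set X) (f : X -> R) :
  compact K -> continuous f -> bounded_on K f.
Proof.
move=> cK cf.
have /compact_bounded : compact (f @` K).
  by apply: continuous_compact => //; exact: continuous_subspaceT.
move=> [M [_ bM]]; exists (M + 1) => _ [z Kz <-].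
by apply: (bM (M + 1)); [rewrite ltrDl|exact: imageP].
Qed.

(** * Series with weights [2 ^- m] and terms saturated by t/(1+t) *)

Section weighted_series.
Context {R : realType}.
Implicit Types (t : R) (u v w : nat -> R).

Lemma saturation_itv t : 0 <= t -> 0 <= t / (1 + t) <= 1.
Proof.
by move=> t0; rewrite divr_ge0 ?ler_pdivrMr//=; lra.
Qed.

Lemma ler_saturation t1 t2 : 0 <= t1 -> t1 <= t2 ->
  t1 / (1 + t1) <= t2 / (1 + t2).
Proof.
move=> t10 t12; rewrite ler_pdivrMr; last lra.
rewrite mulrAC ler_pdivlMr; last lra.
by rewrite !mulrDr !mulr1 lerD// mulrC.
Qed.

(** Split the numerator; each of the two fractions grows when the other summand is dropped from its
    denominator. *)
Lemma saturationD t1 t2 : 0 <= t1 -> 0 <= t2 ->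
  (t1 + t2) / (1 + (t1 + t2)) <= t1 / (1 + t1) + t2 / (1 + t2).
Proof.
move=> t10 t20; rewrite mulrDl; apply: lerD; apply: ler_wpM2l => //.
  by rewrite lef_pV2 ?posrE; lra.
by rewrite lef_pV2 ?posrE; lra.
Qed.

Let term u m : R := 2 ^- m * (u m / (1 + u m)).
(** The index stops before [n], so the weights add up to [1 - 2 ^- n.-1]. *)
Let psum u n : R := \sum_(1 <= m < n) term u m.

Let expV2_gt0 m : 0 < 2 ^- m :> R.
Proof. by rewrite invr_gt0 exprn_gt0. Qed.

Let expV2S m : 2 ^- m = 2 * 2 ^- m.+1 :> R.
Proof. by rewrite exprS invfM mulrA divff ?mul1r. Qed.

Let term_ge0 u m : 0 <= u m -> 0 <= term u m.
Proof.
by move=> u0; rewrite mulr_ge0 ?(ltW (expV2_gt0 _))//; have /andP[] := saturation_itv _ u0.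
Qed.

Let psum_homo u : (forall m, 0 <= u m) ->
  {homo psum u : n m / (n <= m)%N >-> n <= m}.
Proof.
move=> u0; apply: homo_leq => // [|n]; first exact: le_trans.
case: n => [|n]; first by rewrite /psum !big_geq.
by rewrite {2}/psum big_nat_recr//= lerDl term_ge0.
Qed.

(* Splits the partial sums at [N], where the trivial bound [1] takes over from [c]. *)
Let psum_le_split u c N n : (forall m, 0 <= u m) ->
    (forall m, (m <= N)%N -> u m <= c) -> 0 <= c ->
  psum u n <= c * (1 - 2 ^- n.-1) + if (n.-1 <= N)%N then 0 else 2 ^- N - 2 ^- n.-1.
Proof.
move=> u0 uc c0; case: n => [|n]; first by rewrite /psum big_geq//= expr0 invr1; lra.
elim: n => [|n IH]; first by rewrite /psum big_geq//= expr0 invr1; lra.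
rewrite /psum big_nat_recr//= -/(psum u n.+1); have eS := expV2S n.
have e0 := expV2_gt0 n.+1; move: IH => /=.
have /andP[s0 s1] := saturation_itv _ (u0 n.+1).
(* The new term has index [n.+1]: up to [N] it is at most [c] times its weight, beyond [N] at most
   its weight. *)
case: (ltnP n N) => nN IH.
- rewrite (ltnW nN) in IH.
  have : term u n.+1 <= 2 ^- n.+1 * c.
    rewrite ler_pM2l// (le_trans _ (uc _ nN))// ler_pdivrMr; last by have := u0 n.+1; lra.
    by rewrite mulrDr mulr1 lerDl mulr_ge0.
  by rewrite eS in IH; lra.
- have : term u n.+1 <= 2 ^- n.+1 by rewrite -[leRHS]mulr1 ler_pM2l.
  have : 0 <= c * 2 ^- n.+1 by rewrite mulr_ge0// ltW.
  (* At the crossing [n = N] the induction hypothesis has no tail yet; the new weight starts it. *)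
  move: IH; case: ifPn => [nN'|_].
  + have -> : N = n by apply/eqP; rewrite eqn_leq nN nN'.
    by rewrite eS; lra.
  + by rewrite eS; lra.
Qed.

Let psum_le1 u n : (forall m, 0 <= u m) -> psum u n <= 1.
Proof.
(* Index 0 is outside the sum; setting it to 0 allows the split at [N = 0] with [c = 0], which
   leaves only the tail of the weights. *)
move=> u0; pose u' m := if m is 0%N then 0 else u m.
have -> : psum u n = psum u' n by apply: eq_big_nat => -[].
have u'0 m : 0 <= u' m by case: m => /=.
have u'_le0 m : (m <= 0)%N -> u' m <= 0 by case: m.
apply: le_trans (psum_le_split u' 0 0 n u'0 u'_le0 (lexx _)) _.
have e0 := expV2_gt0 n.-1.
by rewrite mul0r add0r expr0 invr1; case: ifP => _; lra.
Qed.

Let psum_cvg u : (forall m, 0 <= u m) -> cvgn (psum u).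
Proof.
move=> u0; apply: nondecreasing_is_cvgn; first exact: psum_homo.
by exists 1 => _ [n _ <-]; exact: psum_le1.
Qed.

Let psum_le_series u n : (forall m, 0 <= u m) -> psum u n <= weighted_series u.
Proof.
by move=> u0; apply: nondecreasing_cvgn_le; [exact: psum_homo|exact: psum_cvg].
Qed.

Let series_le u c : (forall m, 0 <= u m) -> (forall n, psum u n <= c) ->
  weighted_series u <= c.
Proof.
by move=> u0 uc; apply: limr_le; [exact: psum_cvg|exact: nearW].
Qed.

Lemma weighted_series_ge0 u : (forall m, 0 <= u m) -> 0 <= weighted_series u.
Proof. by move=> u0; have := psum_le_series u 0 u0; rewrite /psum big_geq. Qed.

Lemma weighted_series_ge_term u m : (forall m, 0 <= u m) -> (0 < m)%N ->
  2 ^- m * (u m / (1 + u m)) <= weighted_series u.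
Proof.
move=> u0 m0; apply: le_trans (psum_le_series u m.+1 u0).
by rewrite /psum big_nat_recr//= lerDr sumr_ge0// => i _; exact: term_ge0.
Qed.

(** Needs only termwise [u <= v + w], which suits subadditive norms. It gives the triangle
    inequalities for [p] and [gamma] as well as gamma <= p + p^-1. *)
Lemma weighted_seriesD u v w : (forall m, 0 <= u m) -> (forall m, 0 <= v m) ->
  (forall m, 0 <= w m) -> (forall m, u m <= v m + w m) ->
  weighted_series u <= weighted_series v + weighted_series w.
Proof.
move=> u0 v0 w0 uvw; apply: series_le => // n.
apply: le_trans (lerD (psum_le_series v n v0) (psum_le_series w n w0)).
rewrite /psum -big_split/=; apply: ler_sum => m _.
rewrite /term -mulrDr ler_pM2l//.
by rewrite (le_trans _ (saturationD _ _ (v0 m) (w0 m)))// ler_saturation.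
Qed.

Lemma weighted_series0 : weighted_series (fun=> 0 : R) = 0.
Proof.
apply/eqP; rewrite eq_le weighted_series_ge0// andbT; apply: series_le => // n.
by rewrite /psum big1// => m _; rewrite /term mul0r mulr0.
Qed.

Lemma ler_weighted_series u v : (forall m, 0 <= u m) -> (forall m, u m <= v m) ->
  weighted_series u <= weighted_series v.
Proof.
move=> u0 uv; rewrite -[leRHS]addr0 -weighted_series0.
by apply: weighted_seriesD => // m; [exact: le_trans (uv m)|rewrite addr0].
Qed.

(** Up to [N] the saturated terms are at most [u N] and their weights total at most 1; the later
    weights total [2 ^- N]. *)
Lemma weighted_series_le_split u N : (forall m, 0 <= u m) ->
  (forall m, (m <= N)%N -> u m <= u N) -> weighted_series u <= u N + 2 ^- N.
Proof.
move=> u0 uN; apply: series_le => // n.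
apply: (le_trans (psum_le_split u _ N n u0 uN (u0 N))).
have e0 := expV2_gt0 n.-1; have e1 := expV2_gt0 N.
have : 0 <= u N * 2 ^- n.-1 by rewrite mulr_ge0// ltW.
by case: ifP => _; lra.
Qed.

Lemma weighted_series_eq0 u m : (forall m, 0 <= u m) -> weighted_series u = 0 ->
  (0 < m)%N -> u m = 0.
Proof.
move=> u0 wu m0; have := weighted_series_ge_term u m u0 m0.
rewrite wu pmulr_rle0// ler_pdivrMr ?mul0r => [um|]; last by have := u0 m; lra.
by apply/eqP; rewrite eq_le um u0.
Qed.

End weighted_series.

(** * Compactness and covering properties of the exhaustion *)

Section lorentzian.
Context {R : realType} {X : topologicalType} {d : X -> X -> R}.
Hypothesis ld : lorentzian_metric_space d.

Lemma lms_continuousr x : continuous (d x).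
Proof.
move=> y; apply: (@continuous_comp _ _ _ (fun y => (x, y)) (fun z => d z.1 z.2)).
  by apply: cvg_pair; [exact: cvg_cst|exact: cvg_id].
exact: (lms_continuous ld).
Qed.

Lemma lms_continuousl x : continuous (d^~ x).
Proof.
move=> y; apply: (@continuous_comp _ _ _ (fun y => (y, x)) (fun z => d z.1 z.2)).
  by apply: cvg_pair; [exact: cvg_id|exact: cvg_cst].
exact: (lms_continuous ld).
Qed.

Lemma chronology_trans x y z : 0 < d x y -> 0 < d y z -> 0 < d x z.
Proof.
move=> xy yz; apply: lt_le_trans (lms_reverse_triangle ld xy yz).
by rewrite addr_gt0.
Qed.

Lemma diamondS (A B : set X) : A `<=` B -> diamond d A `<=` diamond d B.
Proof. by move=> AB; apply: setISS; exact: bigcup_subset. Qed.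

Lemma near_diamond (A : set X) z : diamond d A z -> \near z, diamond d A z.
Proof.
move=> [[p Ap zp] [q Aq zq]].
have np : \near z, 0 < d p z by exact: cvgr_gt (lms_continuousr p z) _ zp.
have nq : \near z, 0 < d z q by exact: cvgr_gt (lms_continuousl q z) _ zq.
by near=> t; split; [exists p => //; near: t|exists q => //; near: t].
Unshelve. all: by end_near. Qed.

Variable s : nat -> X.
Hypothesis gs : generating_sequence d s.

Lemma generating_sequenceP x : exists i j, 0 < d (s i) x /\ 0 < d x (s j).
Proof.
have : diamond d (range s) x by rewrite gs.
by move=> [[_ [i _ <-] ix] [_ [j _ <-] jx]]; exists i, j.
Qed.

(* For p' << q << x and y << p'', every z in the closure satisfies
   d(q, z) >= d(q, x) > 0, so {q} * closure lies in the compact set of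
   condition (ii) for p', p'' and eps = d(q, x). *)
Lemma compact_closure_diamond x y : compact (closure (future d x `&` past d y)).
Proof.
have [i [_ [qx _]]] := generating_sequenceP x; set q := s i in qx.
have [k [_ [pq _]]] := generating_sequenceP q; set p' := s k in pq.
have [_ [l [_ yp]]] := generating_sequenceP y; set p'' := s l in yp.
set D := future d x `&` past d y.
(* A point [t] of [D] gives the chain q << x << t << y << p'', which puts [q] in the diamond of [p']
   and [p'']. *)
have [->|/set0P[t [xt ty]]] := eqVneq D set0.
  by rewrite closure0; exact: compact0.
have C := @lms_compact _ _ _ ld p' p'' _ qx.
(* Projecting to the second coordinate keeps compactness and turns the slice at [q] into a subset of
   [X]. *)
have {}C : compact (snd @` (distant d (d q x) `&`
    (closure (diamond d [set p'; p'']) `*` closure (diamond d [set p'; p''])))).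
  by apply: continuous_compact C; apply: continuous_subspaceT => z; exact: cvg_snd.
apply: subclosed_compact (@closed_closure _ _) C _ => z Dz.
exists (q, z) => //; split => /=.
- have cl : closed (d q @^-1` [set r | d q x <= r]).
    by apply: closed_comp (@closed_ge _ _) => w _; exact: lms_continuousr.
  apply: cl; apply: closure_subset Dz => w [xw _] /=.
  have := lms_reverse_triangle ld qx xw; apply: le_trans.
  by rewrite lerDl ltW.
- split => /=.
  + apply: subset_closure; split; [exists p'|exists p''] => //=; [by left|by right|].
    by apply: chronology_trans yp; apply: chronology_trans ty; exact: chronology_trans xt.
  + apply: closure_subset Dz => w [xw wy]; split.
    * exists p'; [by left|]; rewrite /future/=.
      by apply: chronology_trans xw; exact: chronology_trans qx.
    * by exists p''; [right|exact: chronology_trans yp].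
Qed.

(** A diamond of finitely many points is the union of the sets [future d (s i)]&[past d (s j)]; its
    closure is a closed subset of the finite union [B] of their compact closures. *)
Lemma compact_exhaustion m : compact (exhaustion d s m).
Proof.
apply: compactU; last by apply: finite_compact; exact: finite_image.
pose D i j := closure (future d (s i) `&` past d (s j)).
pose B := \bigcup_(i < m) \bigcup_(j < m) D i j.
have cB : compact B.
  rewrite /B bigcup_mkord; apply: bigsetU_compact => i _.
  rewrite bigcup_mkord; apply: bigsetU_compact => j _.
  exact: compact_closure_diamond.
apply: (subclosed_compact (@closed_closure _ _) cB).
have -> : B = closure B.
  apply/closure_id; apply: closed_bigcup => // i _; apply: closed_bigcup => // j _.
  exact: closed_closure.
apply: closure_subset => z [[_ [i im <-] iz] [_ [j jm <-] jz]].
by exists i => //; exists j => //; exact: subset_closure.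
Qed.

Lemma exhaustionS m n : (m <= n)%N -> exhaustion d s m `<=` exhaustion d s n.
Proof.
move=> mn; have sS : s @` `I_m `<=` s @` `I_n.
  by apply: image_subset => i /= im; exact: leq_trans mn.
by apply: setUSS => //; apply: closure_subset; exact: diamondS.
Qed.

(** Near each point, membership in the diamond of the first [n] points holds for all large [n];
    compactness, in its near-covering form along [\oo], makes the threshold uniform on [K]. *)
Lemma compact_sub_exhaustion (K : set X) : compact K ->
  exists2 m, (0 < m)%N & K `<=` exhaustion d s m.
Proof.
move=> /compact_near_coveringP cK.
have [x _|N _ HN] := cK nat \oo (fun m x => diamond d (s @` `I_m) x) _.
  have [i [j [ix xj]]] := generating_sequenceP x.
  have xD : diamond d (s @` `I_(maxn i j).+1) x.
    split; [exists (s i) => //; exists i|exists (s j) => //; exists j] => //=.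
      by rewrite ltnS leq_maxl.
    by rewrite ltnS leq_maxr.
  exists ([set z | diamond d (s @` `I_(maxn i j).+1) z],
          [set n | ((maxn i j).+1 <= n)%N]).
    by split => /=; [exact: near_diamond|exists (maxn i j).+1].
  move=> [z n] [/= Dz ijn]; apply: diamondS Dz; apply: image_subset => k /= kij.
  exact: leq_trans ijn.
(* The successor makes the index positive, as the series start at 1. *)
exists N.+1 => // z Kz; left; apply: subset_closure.
by apply: (HN N.+1) => //=.
Qed.

Lemma exhaustion_cover z : exists2 m, (0 < m)%N & exhaustion d s m z.
Proof.
have [m m0 zm] := compact_sub_exhaustion _ (@compact_set1 _ z).
by exists m => //; exact: zm.
Qed.

Lemma bounded_on_exhaustionr x y m :
  bounded_on (exhaustion d s m) (d y \- d x).
Proof.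
apply: continuous_bounded_on (compact_exhaustion m) _ => z.
by apply: cvgB; exact: lms_continuousr.
Qed.

Lemma bounded_on_exhaustionl x y m :
  bounded_on (exhaustion d s m) (d^~ x \- d^~ y).
Proof.
apply: continuous_bounded_on (compact_exhaustion m) _ => z.
by apply: cvgB; exact: lms_continuousl.
Qed.

End lorentzian.

(** * Small positive real bounds *)

Lemma invf_expn2_lt (R : realType) (e : R) : 0 < e -> exists N, 2 ^- N < e.
Proof.
move=> e0; have /archi_boundP : 0 <= e^-1 by rewrite invr_ge0 ltW.
set N := Num.Def.archi_bound _ => eN; exists N.
rewrite invf_plt ?posrE ?exprn_gt0// (lt_trans eN)//.
by rewrite -natrX ltr_nat ltn_expl.
Qed.

(** The two bounds of a fine entourage may be infinite; one real [e] below both replaces them. *)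
Lemma fin_lower_bound (R : realType) (a b : \bar R) : (0 < a)%E -> (0 < b)%E ->
  exists2 e : R, 0 < e & (e%:E <= a)%E && (e%:E <= b)%E.
Proof.
have fin (c : \bar R) : (0 < c)%E -> exists2 e : R, 0 < e & (e%:E <= c)%E.
  case: c => [r| |]//; rewrite ?lte_fin => r0; first by exists r.
  by exists 1 => //; rewrite leey.
move=> /fin[e e0 ea] /fin[e' e'0 eb]; exists (Num.min e e').
  by rewrite lt_min e0.
by apply/andP; split; [apply: le_trans ea|apply: le_trans eb];
  rewrite lee_fin ge_min lexx ?orbT.
Qed.

(** * The two halves of [p] and of [gamma], treated uniformly *)

Section exhaustion_distances.
Context {R : realType} {X T : Type} (E : nat -> set T) (f : X -> T -> R).
Hypothesis bf : forall x y m, bounded_on (E m) (f y \- f x).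

(** Taking [f x = d x] gives the first series of [p]; taking [f x t = - d t x] gives the second,
    since the sign reverses the difference. *)
Definition exhaustion_quasi_dist (x y : X) : R :=
  weighted_series (fun m => sup_norm_pos (E m) (f y \- f x)).

Definition exhaustion_dist (x y : X) : R :=
  weighted_series (fun m => sup_norm (E m) (f x \- f y)).

Local Notation q := exhaustion_quasi_dist.
Local Notation g := exhaustion_dist.

Lemma exhaustion_quasi_dist_ge0 x y : 0 <= q x y.
Proof. by apply: weighted_series_ge0 => m; exact: sup_norm_pos_ge0. Qed.

Lemma exhaustion_quasi_dist_refl x : q x x = 0.
Proof.
rewrite -[RHS](@weighted_series0 R); congr weighted_series; apply/funext => m.
apply/eqP; rewrite eq_le sup_norm_pos_ge0 andbT.
by apply: sup_norm_pos_le => // z _; rewrite /= subrr.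
Qed.

Lemma exhaustion_quasi_dist_triangle x y z : q x z <= q x y + q y z.
Proof.
apply: weighted_seriesD => m; rewrite ?sup_norm_pos_ge0//.
have -> : f z \- f x = (f y \- f x) \+ (f z \- f y).
  by apply/funext => t /=; ring.
exact: sup_norm_posD.
Qed.

(** A vanishing series of nonnegative terms has all its terms zero, and every [t] lies in some [E m]
    with a positive index. *)
Lemma exhaustion_quasi_dist_eq0 x y :
    (forall t, exists2 m, (0 < m)%N & E m t) ->
  q x y = 0 <-> forall t, f y t <= f x t.
Proof.
move=> cE; split=> [qxy t|fyx].
- have [m m0 Et] := cE t.
  have := weighted_series_eq0 _ m (fun m => sup_norm_pos_ge0 _ _) qxy m0.
  by rewrite -subr_le0 => <-; apply: (le_sup_norm_pos _ (f y \- f x)).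
- rewrite -[RHS](@weighted_series0 R); congr weighted_series; apply/funext => m.
  apply/eqP; rewrite eq_le sup_norm_pos_ge0 andbT.
  by apply: sup_norm_pos_le => // z _; rewrite /= subr_le0.
Qed.

(** The inclusions in [E N] make the [N]-th norm the largest of those up to [N], so the series
    splits there. *)
Lemma exhaustion_quasi_dist_le x y N e : 0 <= e ->
    (forall m, (m <= N)%N -> E m `<=` E N) ->
    (forall t, E N t -> f y t - f x t <= e) ->
  q x y <= e + 2 ^- N.
Proof.
move=> e0 EN fe; have := @weighted_series_le_split R
  (fun m => sup_norm_pos (E m) (f y \- f x)) N (fun m => sup_norm_pos_ge0 _ _).
move=> H; apply: (le_trans (H _)) => [m mN|].
  by apply: le_sup_norm_posS => //; exact: EN.
by rewrite lerD2r; exact: sup_norm_pos_le.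
Qed.

(** As t/(1+t) is increasing, a norm of at least [e] would already lift the [m]-th term alone to the
    threshold. *)
Lemma sup_norm_pos_lt x y m e : (0 < m)%N -> 0 < e ->
  q x y < 2 ^- m * (e / (1 + e)) -> sup_norm_pos (E m) (f y \- f x) < e.
Proof.
move=> m0 e0 qe; rewrite ltNge; apply/negP => /(ler_saturation _ _ (ltW e0)).
apply/negP; rewrite -ltNge -(@ltr_pM2l _ (2 ^- m)) ?invr_gt0 ?exprn_gt0//.
apply: le_lt_trans qe.
by apply: (weighted_series_ge_term (fun m => sup_norm_pos (E m) (f y \- f x)))
  => // k; exact: sup_norm_pos_ge0.
Qed.

Lemma exhaustion_dist_sym x y : g x y = g y x.
Proof.
congr weighted_series; apply/funext => m; rewrite -sup_normN.
by congr sup_norm; apply/funext => t /=; ring.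
Qed.

Lemma exhaustion_dist_triangle x y z : g x z <= g x y + g y z.
Proof.
apply: weighted_seriesD => m; rewrite ?sup_norm_ge0//.
have -> : f x \- f z = (f x \- f y) \+ (f y \- f z).
  by apply/funext => t /=; ring.
exact: sup_normD.
Qed.

Lemma exhaustion_dist_le x y : g x y <= q x y + q y x.
Proof.
(* [g] uses [f x \- f y] and [q] uses [f y \- f x]; the swap aligns them. *)
rewrite exhaustion_dist_sym; apply: weighted_seriesD => m;
  rewrite ?sup_norm_pos_ge0 ?sup_norm_ge0//.
apply: le_trans (sup_norm_le_max _ _ (bf _ _ _)) _.
have -> : \- (f y \- f x) = f x \- f y by apply/funext => t /=; ring.
by rewrite ge_max lerDl lerDr !sup_norm_pos_ge0.
Qed.

Lemma exhaustion_quasi_dist_le_dist x y : q x y <= g x y.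
Proof.
rewrite exhaustion_dist_sym; apply: ler_weighted_series => m.
  exact: sup_norm_pos_ge0.
exact: sup_norm_pos_le_sup_norm.
Qed.

End exhaustion_distances.

(** * The quasi-metric [p], its quasi-uniformity and the metric [gamma] *)

Theorem theorem7p15 (R : realType) (X : topologicalType) (d : X -> X -> R)
    (s : nat -> X) :
  lorentzian_metric_space d ->
  countably_generated d ->
  generating_sequence d s ->
  let p := generated_quasi_metric d s in
  let gamma := generated_metric d s in
  let p_sym := fun x y => p x y + p y x in
  [/\ quasi_metric_for (fine_quasi_uniformity d) p,
      extended_causal d = [set z | p z.1 z.2 = 0],
      metric gamma,
      lipschitz_equivalent gamma p_sym &
      forall x y, gamma x y <= p_sym x y <= 2 * gamma x y].
Proof.
move=> ld _ gs p gamma p_sym.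
pose E := exhaustion d s; pose f x t := - d t x.
have bd x y m : bounded_on (E m) (d y \- d x) by exact: bounded_on_exhaustionr.
have fE x y : f y \- f x = d^~ x \- d^~ y by apply/funext => t; rewrite /f/=; ring.
have bf x y m : bounded_on (E m) (f y \- f x).
  by rewrite fE; exact: bounded_on_exhaustionl.
have pE x y : p x y = exhaustion_quasi_dist E d x y + exhaustion_quasi_dist E f x y.
  by rewrite /exhaustion_quasi_dist fE.
(* The second series of [gamma] is [exhaustion_dist E f] with its arguments swapped, hence the use
   of symmetry. *)
have gE x y : gamma x y = exhaustion_dist E d x y + exhaustion_dist E f x y.
  by rewrite (exhaustion_dist_sym E f) /exhaustion_dist fE.
have q0 := @exhaustion_quasi_dist_ge0 R X X E.
have cover := exhaustion_cover ld _ gs.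
have p_ge0 x y : 0 <= p x y by rewrite pE addr_ge0.
have pxx x : p x x = 0 by rewrite pE !exhaustion_quasi_dist_refl addr0.
have p_triangle x y z : p x z <= p x y + p y z.
  have := exhaustion_quasi_dist_triangle E d bd x y z.
  by have := exhaustion_quasi_dist_triangle E f bf x y z; rewrite !pE; lra.
have p_eq0 x y : p x y = 0 <-> forall t, d t x <= d t y /\ d y t <= d x t.
  rewrite pE; split=> [/eqP|H].
  - rewrite paddr_eq0// => /andP[/eqP qd /eqP qf] t; split.
      by rewrite -lerN2; move: t; exact/(exhaustion_quasi_dist_eq0 E f bf).
    by move: t; exact/(exhaustion_quasi_dist_eq0 E d bd).
  - rewrite (exhaustion_quasi_dist_eq0 E d bd _ _ cover).2 => [|t]; last by have [] := H t.
    rewrite (exhaustion_quasi_dist_eq0 E f bf _ _ cover).2 ?addr0// => t.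
    by rewrite lerN2; have [] := H t.
(* If [p] vanishes both ways, then [x] and [y] have equal distances to and from every point, so
   condition (iii) identifies them. *)
have p_sep x y : p x y = 0 -> p y x = 0 -> x = y.
  move=> /p_eq0 xy /p_eq0 yx; apply: contrapT => /(lms_separating ld)[z].
  have [zxy yzx] := xy z; have [zyx xzy] := yx z.
  by case; apply; apply/eqP; rewrite eq_le ?yzx ?xzy ?zxy ?zyx.
have gp x y : gamma x y <= p_sym x y <= 2 * gamma x y.
  rewrite /p_sym !pE gE; apply/andP; split.
    have := exhaustion_dist_le E d bd x y.
    by have := exhaustion_dist_le E f bf x y; lra.
  have := exhaustion_quasi_dist_le_dist E d bd x y.
  have := exhaustion_quasi_dist_le_dist E f bf x y.
  have := exhaustion_quasi_dist_le_dist E d bd y x.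
  have := exhaustion_quasi_dist_le_dist E f bf y x.
  by rewrite !(exhaustion_dist_sym E _ y x); lra.
split=> //.
- split; first by [].
  rewrite eqEsubset; split; apply: smallest_sub; try exact: smallest_filter_filter.
  + move=> _ [n [n0 ->]].
    (* A quarter: each half of [p] is at most [e + 2 ^- N], with [2 ^- N < e], so the total stays
       below [4 * e]. *)
    have e0 : 0 < n%:R^-1 / 4 :> R by rewrite divr_gt0// invr_gt0 ltr0n.
    have [N Ne] := invf_expn2_lt _ _ e0; set e := n%:R^-1 / 4 in e0 Ne.
    have GF := @smallest_filter_filter (X * X)%type
      [set A | exists K a b, [/\ compact K, (0 < a)%E, (0 < b)%E & A = fine_entourage d K a b]].
    apply: (@filterS _ _ GF (fine_entourage d (E N) e%:E e%:E)); last first.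
      apply: sub_gen_smallest; exists (E N), e%:E, e%:E.
      by split=> //; exact: compact_exhaustion.
    have le (h : X -> R) : (ereal_sup [set (h t)%:E | t in E N] < e%:E)%E ->
        forall t, E N t -> h t <= e.
      move=> he t Et; rewrite -lee_fin; apply: le_trans (ltW he).
      by apply: ereal_sup_ubound; exists t.
    move=> [x y] [/= /le xyd /le xyf]; rewrite pE.
    have EN m : (m <= N)%N -> E m `<=` E N by exact: exhaustionS.
    have := exhaustion_quasi_dist_le E d bd x y N e (ltW e0) EN xyd.
    have : exhaustion_quasi_dist E f x y <= e + 2 ^- N.
      apply: exhaustion_quasi_dist_le (ltW e0) EN _ => // t Et.
      by rewrite /f opprK addrC xyf.
    by rewrite /e in Ne *; lra.
  + move=> _ [K [a [b [cK a0 b0 ->]]]].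
    have [e e0 /andP[ea eb]] := fin_lower_bound _ _ _ a0 b0.
    have [m m0 KE] := compact_sub_exhaustion ld _ gs _ cK.
    (* If [p x y < c], both halves are below [c], and so both one-sided norms on [E m] are below
       [e]. *)
    set c := 2 ^- m * (e / (1 + e)) : R.
    have c0 : 0 < c by rewrite mulr_gt0 ?invr_gt0 ?exprn_gt0// divr_gt0//; lra.
    have /archi_boundP : 0 <= c^-1 by rewrite invr_ge0 ltW.
    set n := Num.Def.archi_bound _ => cn.
    have n0 : 0 < n%:R :> R by apply: lt_trans cn; rewrite invr_gt0.
    have GF := @smallest_filter_filter (X * X)%type
      [set A | exists n : nat, (0 < n)%N /\ A = [set z | p z.1 z.2 < n%:R^-1]].
    apply: (@filterS _ _ GF [set z | p z.1 z.2 < n%:R^-1]); last first.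
      by apply: sub_gen_smallest; exists n; rewrite -(ltr0n R).
    move=> [x y] /= pn; have {pn} : p x y < c.
      by apply: lt_trans pn _; rewrite invf_plt ?posrE.
    have sup_lt (h : X -> R) : bounded_on (E m) h -> sup_norm_pos (E m) h < e ->
        (ereal_sup [set (h t)%:E | t in K] < e%:E)%E.
      move=> bh he; apply: (@le_lt_trans _ _ (sup_norm_pos (E m) h)%:E); last by rewrite lte_fin.
      apply: ge_ereal_sup => _ [t Kt <-]; rewrite lee_fin.
      by apply: le_sup_norm_pos => //; exact: KE.
    have qd0 := q0 d x y; have qf0 := q0 f x y.
    rewrite pE => pc; split=> /=.
    * apply: lt_le_trans ea; apply: (sup_lt (d y \- d x)) => //.
      by apply: sup_norm_pos_lt => //; rewrite -/c; lra.
    * apply: lt_le_trans eb; apply: (sup_lt (d^~ x \- d^~ y)); rewrite -fE//.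
      by apply: sup_norm_pos_lt => //; rewrite -/c; lra.
- by apply/seteqP; split=> -[x y] /=; rewrite p_eq0.
- split.
  (* Nonnegativity of [gamma], like its separation below, is read off from [p_sym <= 2 * gamma]. *)
  + by move=> x y; have /andP[] := gp x y; have := p_ge0 x y; have := p_ge0 y x;
      rewrite /p_sym; lra.
  + move=> x y; split=> [gxy|<-]; last first.
      have := gp x x; rewrite /p_sym pxx addr0 => /andP[g0 g1].
      by apply/eqP; rewrite eq_le g0; lra.
    have /andP[_] := gp x y; have pxy := p_ge0 x y; have pyx := p_ge0 y x.
    by rewrite gxy mulr0 /p_sym => ps; apply: p_sep; lra.
  + by move=> x y; rewrite !gE !(exhaustion_dist_sym E _ x y).
  + move=> x y z; rewrite !gE.
    have := exhaustion_dist_triangle E d bd x y z.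
    by have := exhaustion_dist_triangle E f bf x y z; lra.
- by exists 1, 2; split=> // x y; rewrite mul1r.
Qed.
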